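(* Suppose that $f$ has the MLR property, i.e. $f(x_1-\eta_1)f(x_2-\eta_2)\ge f(x_1-\eta_2)f(x_2-\eta_1)$ whenever $x_1<x_2$ and $\eta_1<\eta_2$, and that $W$ is absolutely continuous and satisfies (C1)--(C3) (listed in the context). Let $b_0$ be the unique solution of $\int_{-\infty}^{\infty}W'(x-b_0)f(x)F(x)\,dx=0$. Suppose additionally that, for every fixed $t>0$, the equation $$k_1(c\mid t)=\int_{-\infty}^{\infty}W'(z-c)\,[F(z)-F(z-t)]\,f(z)\,dz=0$$ has a unique solution $c=\phi_0(t)$. Then the estimator $\delta_{\phi_0}(\mathbf X)=X_{(2)}-\phi_0(U)$ satisfies $$R(\boldsymbol\theta,\delta_{\phi_0})\le R(\boldsymbol\theta,\delta_{b_0})\quad\text{for all }\boldsymbol\theta\in\mathbb{R}^2,$$ where $\delta_{b_0}(\mathbf X)=X_{(2)}-b_0$.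
   Context: Setting: $f$ is a Lebesgue probability density on $\mathbb{R}$ with distribution function $F(x)=\int_{-\infty}^x f(t)\,dt$; $X_1,X_2$ are independent and $X_i$ has density $x\mapsto f(x-\theta_i)$, where $\boldsymbol\theta=(\theta_1,\theta_2)\in\mathbb{R}^2$ is unknown. Write $\theta_{(2)}=\max\{\theta_1,\theta_2\}$, $X_{(1)}=\min\{X_1,X_2\}$, $X_{(2)}=\max\{X_1,X_2\}$, $U=X_{(2)}-X_{(1)}$ (which is positive almost surely), $\mathbf X=(X_1,X_2)$. The loss for estimating $\theta_{(2)}$ is $L(\boldsymbol\theta,a)=W(a-\theta_{(2)})$, $W:\mathbb{R}\to[0,\infty)$; the risk of $\delta$ is $R(\boldsymbol\theta,\delta)=E_{\boldsymbol\theta}[W(\delta(\mathbf X)-\theta_{(2)})]$. Conditions on $W$: (C1) $W(0)=0$, $W$ is strictly decreasing on $(-\infty,0)$ and strictly increasing on $(0,\infty)$; (C2) $W'$ is increasing almost everywhere; (C3) the integrals involving $W$ are finite and differentiation under the integral sign is permissible. *)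

(* Defs.v *)
From HB Require Import structures.
From mathcomp Require Import all_boot all_order all_algebra.
From mathcomp Require Import all_classical all_reals all_analysis.

Set Implicit Arguments.
Unset Strict Implicit.
Unset Printing Implicit Defensive.

Import Order.TTheory GRing.Theory Num.Theory.
Import numFieldNormedType.Exports.

Local Open Scope classical_set_scope.
Local Open Scope ring_scope.

Section densities.
Context {R : realType}.
Local Notation mu := (@lebesgue_measure R).

Definition is_density (f : R -> R) : Prop :=
  [/\ measurable_fun setT f, (forall x, 0 <= f x)
    & (\int[mu]_x (f x)%:E = 1)%E].

Definition distr_fun (f : R -> R) (x : R) : R :=
  \int[mu]_(t in `]-oo, x]) f t.

Definition MLR (f : R -> R) : Prop :=
  forall x1 x2 eta1 eta2 : R, x1 < x2 -> eta1 < eta2 ->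
    f (x1 - eta2) * f (x2 - eta1) <= f (x1 - eta1) * f (x2 - eta2).

End densities.

Section random_variables.
Context {R : realType} {d : measure_display} {T : measurableType d}.
Local Notation mu := (@lebesgue_measure R).

Definition has_density (P : probability T R) (X : {mfun T >-> R})
    (g : R -> R) : Prop :=
  forall A : set R, measurable A ->
    P (X @^-1` A) = (\int[mu]_(x in A) (g x)%:E)%E.

Definition independent_RV (P : probability T R) (X Y : {mfun T >-> R}) : Prop :=
  forall A B : set R, measurable A -> measurable B ->
    P (X @^-1` A `&` Y @^-1` B) = (P (X @^-1` A) * P (Y @^-1` B))%E.

(* [P th] is the law of the experiment when the parameter is [th]. *)
Definition location_model (f : R -> R) (P : R * R -> probability T R)
    (X1 X2 : {mfun T >-> R}) : Prop :=
  forall th : R * R,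
    [/\ has_density (P th) X1 (fun x => f (x - th.1)),
        has_density (P th) X2 (fun x => f (x - th.2))
      & independent_RV (P th) X1 X2].

Definition min2 (x : R * R) : R := Num.min x.1 x.2.
Definition max2 (x : R * R) : R := Num.max x.1 x.2.

(* Extended-real valued: the integrand is nonnegative, so the risk always
   makes sense and is +oo when the loss is not integrable. *)
Definition risk (W : R -> R) (P : R * R -> probability T R)
    (X1 X2 : {mfun T >-> R}) (th : R * R) (delta : R * R -> R) : \bar R :=
  'E_(P th)[fun w => W (delta (X1 w, X2 w) - max2 th)].

Definition delta_phi (phi : R -> R) (x : R * R) : R :=
  max2 x - phi (max2 x - min2 x).

Definition delta_cst (b : R) (x : R * R) : R := max2 x - b.

End random_variables.

Section loss.
Context {R : realType}.
Local Notation mu := (@lebesgue_measure R).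

Definition abs_continuous_on (W : R -> R) (a b : R) : Prop :=
  forall e : R, 0 < e -> exists2 dlt : R, 0 < dlt &
    forall (n : nat) (u v : 'I_n -> R),
      (forall i, [/\ a <= u i, u i <= v i & v i <= b]) ->
      trivIset setT (fun i => `]u i, v i[%classic) ->
      \sum_(i < n) (v i - u i) < dlt ->
      \sum_(i < n) `|W (v i) - W (u i)| < e.

(* On the whole line, absolute continuity is meant on every compact interval;
   the uniform version would exclude the squared error loss. *)
Definition abs_continuous (W : R -> R) : Prop :=
  forall a b : R, a <= b -> abs_continuous_on W a b.

Definition condC1 (W : R -> R) : Prop :=
  [/\ W 0 = 0,
      (forall x y, x < y -> y < 0 -> W y < W x)
    & (forall x y, 0 < x -> x < y -> W x < W y)].

(* [derive1 W] has an arbitrary value where [W] is not derivable; such points are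
   put in the exceptional null set. *)
Definition condC2 (W : R -> R) : Prop :=
  exists2 N : set R, mu.-negligible N &
    (forall x, ~ N x -> derivable W x 1) /\
    (forall x y, ~ N x -> ~ N y -> x <= y -> derive1 W x <= derive1 W y).

Definition diff_under_integral (W g : R -> R) : Prop :=
  forall c : R,
    [/\ mu.-integrable setT (fun z => (W (z - c) * g z)%:E),
        mu.-integrable setT (fun z => (derive1 W (z - c) * g z)%:E)
      & is_derive c 1 (fun c' => \int[mu]_z (W (z - c') * g z))
          (- \int[mu]_z (derive1 W (z - c) * g z))].

Definition k (W f : R -> R) (b : R) : R :=
  \int[mu]_x (derive1 W (x - b) * f x * distr_fun f x).

Definition k1 (W f : R -> R) (c t : R) : R :=
  \int[mu]_z (derive1 W (z - c) * (distr_fun f z - distr_fun f (z - t)) * f z).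

End loss.

(* [f x * F x] and [(F z - F (z - t)) * f z] are, up to the factor 2, the
   density of X_(2) and that of X_(2) on the event U < t when th = (0, 0);
   they are the weights occurring in [k] and [k1]. *)
Definition condC3 {R : realType} {d : measure_display} {T : measurableType d}
    (W f : R -> R) (P : R * R -> probability T R)
    (X1 X2 : {mfun T >-> R}) : Prop :=
  [/\ diff_under_integral W (fun x => f x * distr_fun f x),
      (forall t : R, 0 < t ->
        diff_under_integral W
          (fun z => (distr_fun f z - distr_fun f (z - t)) * f z))
    & (forall (th : R * R) (b : R),
        (risk W P X1 X2 th (delta_cst b) < +oo)%E)].

(* Main.v *)
(* Since [W'] is increasing and [phi0 t] is the only zero of [k1 (. | t)], the function
   [H_t c = \int W (z - c) (F z - F (z - t)) f z dz], whose derivative is [- k1 (. | t)],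
   decreases strictly up to [phi0 t] and increases strictly afterwards; the same holds for
   [b0] and the weight [f F]. For [c < c'] the difference [W (z - c') - W (z - c)] changes
   sign once, from + to -, so that [H c < H c'] is inherited by every weight whose ratio to
   the original one is nonincreasing. The MLR property provides such ratios: it follows that
   [phi0] is nondecreasing and bounded by [b0], and that, for every theta, replacing a
   constant [c >= phi0 t] by [phi0 t] on the event [U < t] decreases the risk. Performing
   this replacement along the points of a finite grid, from right to left, turns [b0] into
   a step function; these step functions converge to [phi0], which is right continuous, and
   Fatou's lemma concludes. In this discrete version of Kubokawa's argument neither [phi0]
   is differentiated nor [W] recovered from [W']. *)
Require Import Defs.
From HB Require Import structures.
From mathcomp Require Import all_boot all_order all_algebra.
From mathcomp Require Import all_classical all_reals all_analysis.
From mathcomp Require Import measurable_realfun.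
From mathcomp Require Import ring lra.
Set Implicit Arguments.
Unset Strict Implicit.
Unset Printing Implicit Defensive.
Import Order.TTheory GRing.Theory Num.Theory.
Import numFieldNormedType.Exports.
Local Open Scope classical_set_scope.
Local Open Scope ring_scope.

(** * Translation invariance of Lebesgue measure *)

Section translation.
Context {R : realType}.
Local Notation mu := (@lebesgue_measure R).

Lemma measurable_addr (a : R) : measurable_fun setT (fun x : R => x + a).
Proof. by apply: measurable_funD => //; exact: measurable_cst. Qed.

(** By uniqueness: the pushforward under the translation gives every half-open interval its
    length. *)
Lemma lebesgue_measure_translation (a : R) (A : set R) : measurable A ->
  mu [set x | A (x + a)] = mu A.
Proof.
move=> mA; have m := measurable_addr a.
pose f : R -> measurableTypeR R := fun x => x + a.
transitivity (pushforward mu f A); first by [].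
apply/esym/lebesgue_measure_unique => //= _ [[p q]] _ <-.
rewrite /pushforward.
have -> : f @^-1` `]p, q] = `](p - a), (q - a)]%classic.
  by apply/seteqP; split => x; rewrite /= !in_itv/= ltrBlDr lerBrDr.
rewrite !lebesgue_measure_itv /= !lte_fin ltrD2r.
by case: ifP => // _; rewrite -!EFinD; congr EFin; ring.
Qed.

Lemma ge0_integral_translation (a : R) (D : set R) (f : R -> \bar R) :
  measurable D -> measurable_fun D f -> (forall x, D x -> 0 <= f x)%E ->
  (\int[mu]_(x in [set x | D (x + a)%R]) f (x + a)%R = \int[mu]_(x in D) f x)%E.
Proof.
move=> mD mf f0.
have := @ge0_integral_pushforward _ _ (measurableTypeR R) (measurableTypeR R) R _ (measurable_addr a) mu D f mD mf.
move=> <-; last by move=> x /[!inE]; exact: f0.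
apply: eq_measure_integral => [|? A mA _]; first exact: measurable_addr.
exact: lebesgue_measure_translation.
Qed.

Lemma negligible_translation (a : R) (N : set R) :
  mu.-negligible N -> mu.-negligible [set x | N (x + a)].
Proof.
move=> [A [mA A0 NA]]; exists [set x | A (x + a)]; split.
- by rewrite -[X in measurable X]setTI; exact: measurable_addr.
- by rewrite lebesgue_measure_translation.
- by move=> x; exact: NA.
Qed.

End translation.

(** * Scaling, comparison and single crossing of integrals *)

Section integrable_scale.
Context {d} {T : measurableType d} {R : realType} (mu : {measure set T -> \bar R}).

Lemma integrable_EFinZl (D : set T) (r : R) (f : T -> R) : measurable D ->
  mu.-integrable D (EFin \o f) -> mu.-integrable D (fun x => (r * f x)%:E).
Proof. by move=> mD fi; exact: (integrableZl mD r fi). Qed.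

Lemma integrable_EFinZr (D : set T) (r : R) (f : T -> R) : measurable D ->
  mu.-integrable D (EFin \o f) -> mu.-integrable D (fun x => (f x * r)%:E).
Proof. by move=> mD fi; exact: (integrableZr mD r fi). Qed.

End integrable_scale.

(** Under (C2) values of [W'] are comparable only off a null set, so the comparison of integrals has
    to tolerate one. *)
Lemma negligible_le_Rintegral {d} {T : measurableType d} {R : realType}
    (mu : {measure set T -> \bar R}) (N : set T) (f g : T -> R) :
  mu.-negligible N -> mu.-integrable setT (EFin \o f) ->
  mu.-integrable setT (EFin \o g) -> (forall x, ~ N x -> f x <= g x) ->
  \int[mu]_x f x <= \int[mu]_x g x.
Proof.
move=> [A [mA A0 NA]] fi gi fg.
rewrite /Rintegral (@negligible_integral _ _ _ mu setT A) //.
rewrite [in leRHS](@negligible_integral _ _ _ mu setT A) //.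
have mD : measurable (setT `\` A) by exact: measurableD.
apply: le_Rintegral => //.
- exact: integrableS fi.
- exact: integrableS gi.
- by move=> x [_ Ax]; apply: fg => Nx; apply/Ax/NA.
Qed.

(** Mean value theorem. Positivity is asked only inside the interval because the derivative of the
    criterion vanishes at its minimizer, which may be an endpoint. *)
Lemma gt0_derive_lt {R : realType} (H dH : R -> R) (a b : R) : a < b ->
  (forall x : R, is_derive x 1 H (dH x)) ->
  (forall x, a < x -> x < b -> 0 < dH x) -> H a < H b.
Proof.
move=> ab HdH dH0.
have cH : {within `[a, b], continuous H}.
  apply: continuous_subspaceT => x.
  apply/differentiable_continuous/derivable1_diffP.
  by case: (HdH x).
have [c + E] := MVT ab (fun x _ => HdH x) cH.
rewrite in_itv/= => /andP[ac cb].
by rewrite -subr_gt0 E mulr_gt0 ?dH0 ?subr_gt0.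
Qed.

(* With [l] the infimum of [g1 / g0] over [{D >= 0}], [D * g1 >= l * (D * g0)] holds pointwise. *)
Lemma single_crossing {R : realType} (D g0 g1 : R -> R) :
  (forall x y, x < y -> 0 <= D y -> 0 <= D x) ->
  (forall x, 0 <= g0 x) -> (forall x, 0 <= g1 x) ->
  (forall x y, x < y -> g1 y * g0 x <= g1 x * g0 y) ->
  lebesgue_measure.-integrable setT (fun x => (D x * g0 x)%:E) ->
  lebesgue_measure.-integrable setT (fun x => (D x * g1 x)%:E) ->
  0 < \int[lebesgue_measure]_x (D x * g0 x) ->
  0 <= \int[lebesgue_measure]_x (D x * g1 x).
Proof.
move=> Ddown g0_ge0 g1_ge0 g10 i0 i1 pos.
pose S := [set g1 x / g0 x | x in [set x | 0 <= D x /\ 0 < g0 x]].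
have [[x0 [Dx0 g0x0]]|noS] := pselect (exists x, 0 <= D x /\ 0 < g0 x); last first.
  (* If [g0] vanished wherever [D >= 0], the integrand [D * g0] would be nonpositive; hence [S] is
     nonempty. *)
  exfalso; suff : \int[lebesgue_measure]_x (D x * g0 x) <= 0 by rewrite leNgt pos.
  rewrite -(_ : \int[@lebesgue_measure R]_x 0 = 0); last first.
    by rewrite /Rintegral integral0.
  apply: le_Rintegral => //; first exact: integrable0.
  move=> x _; have [Dx|/ltW Dx] := leP 0 (D x); last exact: mulr_le0_ge0.
  suff -> : g0 x = 0 by rewrite mulr0.
  apply/eqP; rewrite eq_le g0_ge0 andbT leNgt; apply/negP => gx.
  by apply: noS; exists x.
have Slb : lbound S 0 by move=> _ [x [_ gx] <-]; rewrite divr_ge0// ltW.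
have hiS : has_inf S.
  by split; [exists (g1 x0 / g0 x0); exists x0|exists 0].
pose l := inf S.
have l0 : 0 <= l by apply: lb_le_inf => //; case: hiS.
have key x : l * (D x * g0 x) <= D x * g1 x.
  rewrite mulrCA; have [Dx|Dx] := leP 0 (D x).
    apply: ler_wpM2l => //.
    have := g0_ge0 x; rewrite le_eqVlt => /orP[/eqP <-|gx]; first by rewrite mulr0.
    rewrite -ler_pdivlMr//; apply: ge_inf; last by exists x.
    by exists 0.
  (* Now [D x < 0]: by [Ddown] every point where [D >= 0] lies to the left of [x], so the monotone
     ratio puts [g1 x / g0 x] below [l]. If [g0 x = 0], comparison with [x0] forces [g1 x <= 0]. *)
  apply: ler_wnM2l; first exact: ltW.
  have := g0_ge0 x; rewrite le_eqVlt => /orP[/eqP gx|gx].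
    have x0x : x0 < x.
      rewrite ltNge le_eqVlt; apply/negP => /orP[/eqP xx0|/Ddown/(_ Dx0)].
        by move: Dx; rewrite xx0 ltNge Dx0.
      by rewrite leNgt Dx.
    have := g10 _ _ x0x; rewrite -gx mulr0 => h.
    by rewrite mulr0 -(ler_pM2r g0x0) mul0r.
  rewrite -ler_pdivrMr//; apply: lb_le_inf; first by case: hiS.
  move=> _ [y [Dy gy] <-]; rewrite ler_pdivrMr// mulrAC ler_pdivlMr//.
  apply: g10; rewrite ltNge le_eqVlt; apply/negP => /orP[/eqP xy|/Ddown/(_ Dy)].
    by move: Dx; rewrite xy ltNge Dy.
  by rewrite leNgt Dx.
apply: (@le_trans _ _ (\int[lebesgue_measure]_x (l * (D x * g0 x)))).
  by rewrite RintegralZl// mulr_ge0// ltW.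
apply: le_Rintegral => //.
exact: integrable_EFinZl.
Qed.

(** * Shifts of the loss under (C1) *)

Section loss_shift.
Context {R : realType}.
Variable W : R -> R.
Hypotheses (W_ge0 : forall x, 0 <= W x) (W_C1 : condC1 W).

(** (C1) is strict only inside each open half-line, so the midpoint [x / 2] is interposed between 0
    and [x]. *)
Lemma condC1_gt0 x : x != 0 -> 0 < W x.
Proof.
case: W_C1 => W0 dW iW; rewrite neq_lt => /orP[x0|x0].
  by apply: le_lt_trans (W_ge0 _) (dW x (x / 2) _ _); lra.
by apply: le_lt_trans (W_ge0 _) (iW (x / 2) x _ _); lra.
Qed.

Lemma condC1_dec x y : x <= y -> y <= 0 -> W y <= W x.
Proof.
case: W_C1 => W0 dW iW; rewrite le_eqVlt => /orP[/eqP ->//|xy].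
rewrite le_eqVlt => /orP[/eqP ->|y0]; first by rewrite W0.
exact/ltW/dW.
Qed.

Lemma condC1_inc x y : x <= y -> 0 <= x -> W x <= W y.
Proof.
case: W_C1 => W0 dW iW; rewrite le_eqVlt => /orP[/eqP ->//|xy].
rewrite le_eqVlt => /orP[/eqP <-|y0]; first by rewrite W0.
exact/ltW/iW.
Qed.

(* On [c, c'] one summand increases and the other decreases; to the left of [c]
   the difference is nonnegative and to the right of [c'] it is negative. *)
Lemma condC1_single_crossing (c c' : R) : c < c' -> forall x y, x < y ->
  0 <= W (y - c') - W (y - c) -> 0 <= W (x - c') - W (x - c).
Proof.
move=> cc' x y xy; rewrite !subr_ge0 => h.
have [xc|cx] := leP x c; first by apply: condC1_dec; lra.
have [yc'|c'y] := ltP y c'.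
  apply: (@le_trans _ _ (W (y - c))); first by apply: condC1_inc; lra.
  by apply: (le_trans h); apply: condC1_dec; lra.
exfalso; move: h; rewrite leNgt => /negP; apply.
case: W_C1 => W0 _ iW.
(* At [y = c'] the argument of [W] is 0, which the monotonicity clauses do not reach; positivity of
   [W] off 0 replaces them. *)
move: c'y; rewrite le_eqVlt => /orP[/eqP <-|c'y]; last by apply: iW; lra.
by rewrite subrr W0 condC1_gt0// gt_eqF// subr_gt0.
Qed.

End loss_shift.

(** * Monotonicity of the criterion on either side of its critical point *)

Section convex_criterion.
Context {R : realType}.
Local Notation mu := (@lebesgue_measure R).
Variables (W g : R -> R).
Hypotheses (W_C2 : condC2 W) (g_ge0 : forall x, 0 <= g x).
Hypothesis W_C3 : diff_under_integral W g.

Let H c := \int[mu]_z (W (z - c) * g z).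
Let dH c := \int[mu]_z (derive1 W (z - c) * g z).

(** [W'] is monotone off [N], so [z] must avoid the translates of [N] by both [c] and [c']; their
    union is still null. *)
Lemma shifted_score_nonincreasing c c' : c <= c' -> dH c' <= dH c.
Proof.
move=> cc'; case: W_C2 => N N0 [_ W'nd].
have nN : mu.-negligible ([set z | N (z - c)] `|` [set z | N (z - c')]).
  by apply: negligibleU; exact: negligible_translation.
apply: (negligible_le_Rintegral nN).
- by case: (W_C3 c').
- by case: (W_C3 c).
- move=> z /not_orP[Nc Nc']; apply: ler_wpM2r => //.
  by apply: W'nd => //; lra.
Qed.

Variable c0 : R.
Hypothesis c0_unique : unique (fun c => dH c = 0) c0.

(** The derivative of [H] is [- dH], nonnegative beyond [c0] by monotonicity; a further zero would
    contradict uniqueness, so the increase is strict. *)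
Lemma shifted_loss_increasing c c' : c0 <= c -> c < c' -> H c < H c'.
Proof.
case: c0_unique => dH0 u cc cc'.
apply: (@gt0_derive_lt _ H (fun x => - dH x) _ _ cc') => [x|x cx xc'].
  by case: (W_C3 x).
rewrite oppr_gt0 lt_neqAle -[X in _ <= X]dH0 shifted_score_nonincreasing ?andbT; last lra.
by apply/eqP => /u; lra.
Qed.

Lemma shifted_loss_decreasing c c' : c' <= c0 -> c < c' -> H c' < H c.
Proof.
case: c0_unique => dH0 u cc cc'.
rewrite -ltrN2; apply: (@gt0_derive_lt _ (- H) dH _ _ cc').
  move=> x; rewrite -[dH x]opprK; apply: is_deriveN.
  by case: (W_C3 x).
move=> x cx xc'.
rewrite lt_neqAle -[X in X <= _]dH0 shifted_score_nonincreasing ?andbT; last lra.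
by apply/eqP => /esym /u; lra.
Qed.

End convex_criterion.

(** * The distribution function of a density *)

Section distribution.
Context {R : realType}.
Local Notation mu := (@lebesgue_measure R).
Variable f : R -> R.
Hypothesis f_density : is_density f.
Local Notation F := (distr_fun f).

Lemma density_integrable : mu.-integrable setT (EFin \o f).
Proof.
case: f_density => mf f0 f1; apply/integrableP; split.
  exact/measurable_EFinP.
under eq_integral do rewrite /= ger0_norm//.
by rewrite f1 ltry.
Qed.

Lemma density_integrable_translation (h : R) :
  mu.-integrable setT (fun x => (f (x + h))%:E).
Proof.
case: f_density => mf f0 f1; apply/integrableP; split.
  by apply/measurable_EFinP; exact: measurableT_comp (measurable_addr h).
under eq_integral do rewrite /= ger0_norm//.
rewrite (_ : setT = [set x : R | setT (x + h)])//.
rewrite (@ge0_integral_translation _ h setT (EFin \o f))//.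
- by rewrite f1 ltry.
- exact/measurable_EFinP.
- by move=> x _; rewrite lee_fin.
Qed.

Lemma distr_fun_translation (h q : R) :
  F (q + h) = \int[mu]_(x in `]-oo, q]) f (x + h).
Proof.
case: f_density => mf f0 f1; rewrite /distr_fun /Rintegral; congr fine.
rewrite -(@ge0_integral_translation _ h) //=.
- by congr integral; apply/seteqP; split => x; rewrite /= !in_itv/= lerD2r.
- by apply/measurable_EFinP; exact: measurable_funTS.
- by move=> x _; rewrite lee_fin.
Qed.

Lemma distr_funB_translation (h p q : R) : p <= q ->
  F (q + h) - F (p + h) = \int[mu]_(x in `]p, q]) f (x + h).
Proof.
move=> pq; rewrite !distr_fun_translation Rintegral_itvB //.
exact: integrableS (density_integrable_translation h).
Qed.

Lemma distr_funB (p q : R) : p <= q -> F q - F p = \int[mu]_(x in `]p, q]) f x.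
Proof.
move=> pq; rewrite -[q in LHS]addr0 -[p in LHS]addr0 distr_funB_translation//.
by apply: eq_Rintegral => x _; rewrite addr0.
Qed.

Lemma distr_fun_ge0 x : 0 <= F x.
Proof. by case: f_density => _ f0 _; apply: Rintegral_ge0. Qed.

Lemma distr_fun_nd : {homo F : x y / x <= y}.
Proof.
move=> x y xy; rewrite -subr_ge0 distr_funB//.
by case: f_density => _ f0 _; apply: Rintegral_ge0.
Qed.

Lemma measurable_distr_fun : measurable_fun setT F.
Proof. by apply: nondecreasing_measurable => //; exact: distr_fun_nd. Qed.

(** Near [x], [F] is a constant plus an integral over a bounded interval starting at [x - 1]. *)
Lemma distr_fun_continuous : continuous F.
Proof.
move=> x.
have ab : x - 1 <= x + 1 by lra.
have fi : mu.-integrable `[x - 1, x + 1] (EFin \o f).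
  exact: integrableS density_integrable.
have := parameterized_integral_continuous ab fi.
move/continuous_within_itvP => /(_ _)[|+ _ _]; first by lra.
move=> /(_ x); rewrite in_itv/= => /(_ _) G.
have {}G : \int[mu]_(t in `[x - 1, y]) f t @[y --> x] --> \int[mu]_(t in `[x - 1, x]) f t.
  by apply: G; lra.
have E y : x - 1 <= y -> F y = F (x - 1) + \int[mu]_(t in `[x - 1, y]) f t.
  move=> xy; rewrite -Rintegral_itv_obnd_cbnd; last exact: integrableS density_integrable.
  by rewrite -distr_funB// subrKC.
rewrite /continuous_at (E x); last lra.
apply: (@cvg_trans _ ((fun y => F (x - 1) + \int[mu]_(t in `[x - 1, y]) f t) @ x)).
  apply: near_eq_cvg; near=> y; rewrite -E//.
  by apply: ltW; near: y; apply: lt_nbhsr; lra.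
exact: (cvgD (cvg_cst _) G).
Unshelve. all: by end_near. Qed.

End distribution.

(** * Monotone ratios derived from the MLR property *)

Section monotone_likelihood_ratio.
Context {R : realType}.
Local Notation mu := (@lebesgue_measure R).
Variable f : R -> R.
Hypotheses (f_density : is_density f) (f_MLR : MLR f).
Local Notation F := (distr_fun f).

(** MLR at [x1 = x], [x2 = x + h], [eta1 = x - y], [eta2 = 0]: the ratio [f (z + h) / f z] is
    nonincreasing in [z]. *)
Lemma MLR_translation (x y h : R) : x < y -> 0 < h ->
  f x * f (y + h) <= f y * f (x + h).
Proof.
move=> xy h0.
have := @f_MLR x (x + h) (x - y) 0; rewrite !subr0.
rewrite (_ : x + h - (x - y) = y + h); last by ring.
by rewrite (_ : x - (x - y) = y); [apply; lra|ring].
Qed.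

(** [MLR_translation] integrated over [B] times [A], one variable at a time. *)
Lemma Rintegral_MLR_translation (A B : set R) (h : R) :
  measurable A -> measurable B -> (forall x y, B x -> A y -> x < y) -> 0 < h ->
  (\int[mu]_(x in B) f x) * (\int[mu]_(x in A) f (x + h)) <=
  (\int[mu]_(x in A) f x) * (\int[mu]_(x in B) f (x + h)).
Proof.
move=> mA mB BA h0.
have fi D : measurable D -> mu.-integrable D (EFin \o f).
  by move=> mD; exact: integrableS (density_integrable f_density).
have fhi D : measurable D -> mu.-integrable D (fun x => (f (x + h))%:E).
  by move=> mD; exact: integrableS (density_integrable_translation f_density h).
rewrite -RintegralZl; [|exact: mA|exact: fhi].
rewrite -RintegralZr; [|exact: mA|exact: fi].
apply: le_Rintegral => //.
- by apply: integrable_EFinZl => //; exact: fhi.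
- by apply: integrable_EFinZr => //; exact: fi.
move=> y Ay.
rewrite -RintegralZr; [|exact: mB|exact: fi].
rewrite -RintegralZl; [|exact: mB|exact: fhi].
apply: le_Rintegral => //.
- by apply: integrable_EFinZr => //; exact: fi.
- by apply: integrable_EFinZl => //; exact: fhi.
by move=> x Bx; apply: MLR_translation => //; exact: BA.
Qed.

Lemma distr_funB_ratio (r s p q h : R) : r <= s -> s <= p -> p <= q -> 0 < h ->
  (F s - F r) * (F (q + h) - F (p + h)) <= (F q - F p) * (F (s + h) - F (r + h)).
Proof.
move=> rs sp pq h0; rewrite (distr_funB_translation f_density h pq).
rewrite (distr_funB_translation f_density h rs).
rewrite (distr_funB f_density rs) (distr_funB f_density pq).
apply: Rintegral_MLR_translation => // x y.
by rewrite /= !in_itv/= => /andP[_ xs] /andP[py _]; lra.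
Qed.

Lemma distr_fun_ratio (s p q h : R) : s <= p -> p <= q -> 0 < h ->
  F s * (F (q + h) - F (p + h)) <= (F q - F p) * F (s + h).
Proof.
move=> sp pq h0; rewrite (distr_funB_translation f_density h pq) (distr_fun_translation f_density).
rewrite (distr_funB f_density pq).
apply: Rintegral_MLR_translation => // x y.
by rewrite /= !in_itv/= => xs /andP[py _]; lra.
Qed.

Definition window (t z : R) := F z - F (z - t).

Lemma window_ge0 t z : 0 <= t -> 0 <= window t z.
Proof. by move=> t0; rewrite subr_ge0 distr_fun_nd//; lra. Qed.

(** The window of width [t] is the one of width [s] plus a remainder to its left. The product of the
    two windows of width [s] cancels, and [distr_funB_ratio] handles the remainders. *)
Lemma window_ratio_width (s t x y : R) : 0 <= s -> s <= t -> x < y ->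
  window s y * window t x <= window s x * window t y.
Proof.
move=> s0 st xy; rewrite /window.
have xts : x - t <= x - s by lra.
have xs : x - s <= x by lra.
have yx : 0 < y - x by lra.
have := distr_funB_ratio xts (lexx _) xs yx.
rewrite (_ : x + (y - x) = y); last by ring.
rewrite (_ : x - s + (y - x) = y - s); last by ring.
rewrite (_ : x - t + (y - x) = y - t); last by ring.
move: (F x) (F y) (F (x - s)) (F (x - t)) (F (y - s)) (F (y - t)) => *.
lra.
Qed.

(** The same cancellation, with [F] split at the left end of the window; [F] plays the window of
    infinite width. *)
Lemma window_ratio_distr_fun (t x y : R) : 0 <= t -> x < y ->
  window t y * F x <= window t x * F y.
Proof.
move=> t0 xy; rewrite /window.
have xt : x - t <= x by lra.
have yx : 0 < y - x by lra.
have := distr_fun_ratio (lexx _) xt yx.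
rewrite (_ : x + (y - x) = y); last by ring.
rewrite (_ : x - t + (y - x) = y - t); last by ring.
move: (F x) (F y) (F (x - t)) (F (y - t)) => *.
lra.
Qed.

(* When the windows at [x] and [y] overlap, the overlap contributes equally to both
   sides, and only products over ordered pairs of disjoint intervals remain. *)
Lemma window_ratio_translation (t x y h : R) : 0 <= t -> x < y -> 0 <= h ->
  window t (y + h) * window t x <= window t (x + h) * window t y.
Proof.
move=> t0 xy; rewrite le_eqVlt => /orP[/eqP <-|h0].
  by rewrite !addr0 mulrC.
rewrite /window ![_ + h - t]addrAC.
have xt : x - t <= x by lra.
have yt : y - t <= y by lra.
have [xyt|/ltW ytx] := leP x (y - t).
  rewrite mulrC [leRHS]mulrC; exact: distr_funB_ratio.
have xtyt : x - t <= y - t by lra.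
have H1 := distr_funB_ratio xtyt (lexx _) ytx h0.
have H2 := distr_funB_ratio xtyt ytx (ltW xy) h0.
have H3 := distr_funB_ratio ytx (lexx _) (ltW xy) h0.
move: (F x) (F y) (F (x - t)) (F (y - t)) (F (x + h)) (F (y + h))
  (F (x - t + h)) (F (y - t + h)) H1 H2 H3 {xt yt ytx xtyt} => *.
lra.
Qed.

(* Twice the weight of [k1] when [h = 0]: this is the density of [X_(2) - theta_(2)]
   on the event [U < t] when [theta_(2) - theta_(1) = h]. *)
Definition window_density (t h z : R) :=
  f (z + h) * window t z + f z * window t (z + h).

Lemma window_density_ge0 t h z : 0 <= t -> 0 <= window_density t h z.
Proof.
move=> t0; case: f_density => _ f0 _.
by rewrite addr_ge0// mulr_ge0// window_ge0.
Qed.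

(** Divided by [window t z * f z], the density becomes [f (z + h) / f z + window t (z + h) / window
    t z], a sum of two nonincreasing ratios. Cross products avoid dividing by zero. *)
Lemma window_density_ratio (t h x y : R) : 0 <= t -> 0 <= h -> x < y ->
  window_density t h y * (window t x * f x) <=
  window_density t h x * (window t y * f y).
Proof.
move=> t0 h0 xy; case: (f_density) => _ f0 _.
rewrite /window_density.
have H1 := window_ratio_translation t0 xy h0.
have H2 : f (y + h) * f x <= f (x + h) * f y.
  move: h0; rewrite le_eqVlt => /orP[/eqP <-|h0].
    by rewrite !addr0 mulrC.
  by rewrite mulrC [leRHS]mulrC; exact: MLR_translation.
have {}H1 := ler_wpM2l (mulr_ge0 (f0 x) (f0 y)) H1.
have {}H2 := ler_wpM2l (mulr_ge0 (window_ge0 x t0) (window_ge0 y t0)) H2.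
move: (window t x) (window t y) (window t (x + h)) (window t (y + h)) H1 H2 => *.
lra.
Qed.

End monotone_likelihood_ratio.

(** * Monotonicity, upper bound and right continuity of [phi0] *)

Section shrinkage.
Context {R : realType}.
Local Notation mu := (@lebesgue_measure R).
Variables (W : R -> R).
Hypotheses (W_ge0 : forall x, 0 <= W x) (W_C1 : condC1 W).

(** [single_crossing] applied to the difference of the two shifted losses, whose sign pattern comes
    from (C1). *)
Lemma shifted_loss_transfer (g0 g1 : R -> R) (c c' : R) : c < c' ->
  (forall x, 0 <= g0 x) -> (forall x, 0 <= g1 x) ->
  (forall x y, x < y -> g1 y * g0 x <= g1 x * g0 y) ->
  (forall b, mu.-integrable setT (fun z => (W (z - b) * g0 z)%:E)) ->
  (forall b, mu.-integrable setT (fun z => (W (z - b) * g1 z)%:E)) ->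
  \int[mu]_z (W (z - c) * g0 z) < \int[mu]_z (W (z - c') * g0 z) ->
  \int[mu]_z (W (z - c) * g1 z) <= \int[mu]_z (W (z - c') * g1 z).
Proof.
move=> cc' g0_ge0 g1_ge0 g10 i0 i1.
pose D z := W (z - c') - W (z - c).
have DE (g : R -> R) : (forall b, mu.-integrable setT (fun z => (W (z - b) * g z)%:E)) ->
    mu.-integrable setT (fun z => (D z * g z)%:E) /\
    \int[mu]_z (D z * g z) =
      \int[mu]_z (W (z - c') * g z) - \int[mu]_z (W (z - c) * g z).
  move=> ig; have E z : D z * g z = W (z - c') * g z - W (z - c) * g z.
    by rewrite mulrBl.
  split; last by under eq_Rintegral do rewrite E; exact: (RintegralB measurableT (ig c') (ig c)).
  under eq_fun do rewrite E.
  exact: (integrableB measurableT (ig c') (ig c)).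
have [iD0 E0] := DE _ i0; have [iD1 E1] := DE _ i1.
rewrite -subr_gt0 -E0 -subr_ge0 -E1.
apply: single_crossing => // x y.
exact: (condC1_single_crossing W_ge0 W_C1 cc').
Qed.

Variables (f : R -> R) (b0 : R) (phi0 : R -> R).
Hypothesis W_C2 : condC2 W.
Hypotheses (f_density : is_density f) (f_MLR : MLR f).
Hypothesis C3_F : diff_under_integral W (fun x => f x * distr_fun f x).
Hypothesis C3_window : forall t : R, 0 < t ->
  diff_under_integral W (fun z => (distr_fun f z - distr_fun f (z - t)) * f z).
Hypothesis b0_unique : unique (fun b => k W f b = 0) b0.
Hypothesis phi0_unique : forall t : R, 0 < t -> unique (fun c => k1 W f c t = 0) (phi0 t).

Local Notation F := (distr_fun f).
Let w t z := window f t z * f z.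

Let f_ge0 x : 0 <= f x. Proof. by case: f_density. Qed.

Let w_ge0 (t z : R) : 0 < t -> 0 <= w t z.
Proof. by move=> t0; apply: mulr_ge0 => //; apply: window_ge0 => //; exact: ltW. Qed.

Lemma integrable_window_loss (t c : R) : 0 < t ->
  mu.-integrable setT (fun z => (W (z - c) * (window f t z * f z))%:E).
Proof. by move=> t0; case: (C3_window t0 c). Qed.

Let phi0_critical (t : R) : 0 < t ->
  unique (fun c => \int[mu]_z (derive1 W (z - c) * w t z) = 0) (phi0 t).
Proof.
move=> t0; have := phi0_unique t0; rewrite /k1 /w.
by under eq_fun do under eq_Rintegral do rewrite -mulrA.
Qed.

Let b0_critical :
  unique (fun b => \int[mu]_z (derive1 W (z - b) * (f z * F z)) = 0) b0.
Proof.
by have := b0_unique; rewrite /k; under eq_fun do under eq_Rintegral do rewrite -mulrA.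
Qed.

Lemma window_loss_increasing (t c c' : R) : 0 < t -> phi0 t <= c -> c < c' ->
  \int[mu]_z (W (z - c) * (window f t z * f z)) <
  \int[mu]_z (W (z - c') * (window f t z * f z)).
Proof.
move=> t0.
exact: (shifted_loss_increasing W_C2 (fun x => w_ge0 x t0) (C3_window t0) (phi0_critical t0)).
Qed.

Lemma window_loss_decreasing (t c c' : R) : 0 < t -> c' <= phi0 t -> c < c' ->
  \int[mu]_z (W (z - c') * (window f t z * f z)) <
  \int[mu]_z (W (z - c) * (window f t z * f z)).
Proof.
move=> t0.
exact: (shifted_loss_decreasing W_C2 (fun x => w_ge0 x t0) (C3_window t0) (phi0_critical t0)).
Qed.

(** If [phi0 t < phi0 s], going up from [phi0 t] to [phi0 s] raises the criterion of [t], hence does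
    not lower that of [s], since [w s / w t] is nonincreasing. But the criterion of [s] strictly
    decreases up to [phi0 s]. *)
Lemma phi0_nd (s t : R) : 0 < s -> s <= t -> phi0 s <= phi0 t.
Proof.
move=> s0 st; have t0 := lt_le_trans s0 st.
rewrite leNgt; apply/negP => ts.
have := window_loss_decreasing s0 (lexx _) ts; rewrite ltNge => /negP; apply.
apply: (@shifted_loss_transfer (w t)) => //.
- by move=> x; exact: w_ge0.
- by move=> x; exact: w_ge0.
- move=> x y xy; rewrite /w.
  have /(ler_wpM2r (mulr_ge0 (f_ge0 x) (f_ge0 y))) :=
    window_ratio_width f_density f_MLR (ltW s0) st xy.
  by move=> r; rewrite mulrACA [leRHS]mulrACA [f y * f x]mulrC.
- by move=> b; exact: integrable_window_loss.
- by move=> b; exact: integrable_window_loss.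
- exact: window_loss_increasing.
Qed.

(** The argument of [phi0_nd], with [f F] as the weight of the wider window and [b0] as its
    minimizer. *)
Lemma phi0_le_b0 (t : R) : 0 < t -> phi0 t <= b0.
Proof.
move=> t0; rewrite leNgt; apply/negP => bt.
have := window_loss_decreasing t0 (lexx _) bt; rewrite ltNge => /negP; apply.
apply: (@shifted_loss_transfer (fun z => f z * F z)) => //.
- by move=> x; rewrite mulr_ge0// distr_fun_ge0.
- by move=> x; exact: w_ge0.
- move=> x y xy.
  have /(ler_wpM2r (mulr_ge0 (f_ge0 x) (f_ge0 y))) :=
    window_ratio_distr_fun f_density f_MLR (ltW t0) xy.
  by move=> r; rewrite [f x * F x]mulrC [f y * F y]mulrC mulrACA [leRHS]mulrACA [f y * f x]mulrC.
- by move=> b; case: (C3_F b).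
- by move=> b; exact: integrable_window_loss.
- apply: (shifted_loss_increasing W_C2 _ C3_F b0_critical) => //.
  by move=> x; rewrite mulr_ge0// distr_fun_ge0.
Qed.

(** Dominated convergence: all these windows lie in the one of width [t + 1], and continuity of [F]
    gives the pointwise limit. *)
Lemma window_loss_cvg (t : R) c : 0 < t ->
  (\int[mu]_z (W (z - c) * (window f (t + n.+1%:R^-1) z * f z))%:E)%E
    @[n --> \oo] --> (\int[mu]_z (W (z - c) * (window f t z * f z))%:E)%E.
Proof.
move=> t0; have tn n : 0 < t + n.+1%:R^-1 :> R by rewrite addr_gt0// invr_gt0.
have mI (s : R) : 0 < s -> measurable_fun setT (fun z : R => (W (z - c) * (window f s z * f z))%:E).
  by move=> s0; exact: measurable_int (integrable_window_loss c s0).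
have [] := @dominated_convergence _ _ _ mu setT measurableT
  (fun n (z : R) => (W (z - c) * (window f (t + n.+1%:R^-1) z * f z))%:E)
  (fun z : R => (W (z - c) * (window f t z * f z))%:E)
  (fun z : R => (W (z - c) * (window f (t + 1) z * f z))%:E) => //.
- by move=> n; exact: mI.
- exact: mI.
- apply: aeW => z _; apply: cvg_EFin; first by near=> n.
  have h : t + n.+1%:R^-1 @[n --> \oo] --> t.
    by rewrite -[X in _ --> X]addr0; exact: (cvgD (cvg_cst _) cvg_harmonic).
  have hF : F (z - (t + n.+1%:R^-1)) @[n --> \oo] --> F (z - t).
    have hz : z - (t + n.+1%:R^-1) @[n --> \oo] --> z - t by exact: (cvgB (cvg_cst _) h).
    exact: (cvg_comp _ _ hz (@distr_fun_continuous _ _ f_density (z - t))).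
  exact: (cvgM (cvg_cst _) (cvgM (cvgB (cvg_cst _) hF) (cvg_cst _))).
- by apply: integrable_window_loss; lra.
- apply: aeW => z n _; rewrite /= lee_fin ger0_norm; last first.
    by rewrite mulr_ge0// w_ge0.
  apply: ler_wpM2l => //; apply: ler_wpM2r => //.
  rewrite lerD2l lerN2 distr_fun_nd// lerD2l lerN2 lerD2l.
  by rewrite invf_le1// ler1n.
Unshelve. all: by end_near. Qed.

(** Otherwise [phi0 t + e] stays below the minimizers for all the widths [t + 1/(n+1)], whose
    criteria are then smaller at [phi0 t + e] than at [phi0 t]. In the limit this contradicts the
    strict increase beyond [phi0 t]. *)
Lemma phi0_right_continuous (t e : R) : 0 < t -> 0 < e ->
  exists n, phi0 (t + n.+1%:R^-1) <= phi0 t + e.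
Proof.
move=> t0 e0; apply: contrapT => /forallNP h.
have lt : phi0 t < phi0 t + e by rewrite ltrDl.
have := window_loss_increasing t0 (lexx _) lt; rewrite ltNge => /negP; apply.
apply: fine_le.
- exact: integrable_fin_num (integrable_window_loss _ t0).
- exact: integrable_fin_num (integrable_window_loss _ t0).
apply: (lee_cvg_to (window_loss_cvg t0) (window_loss_cvg t0)).
near=> n.
have tn : 0 < t + n.+1%:R^-1 :> R by rewrite addr_gt0// invr_gt0.
have /negP := h n; rewrite -ltNge => /ltW hn.
have := window_loss_decreasing tn hn lt.
rewrite -lte_fin !fineK => [/ltW//||].
- exact: integrable_fin_num (integrable_window_loss _ tn).
- exact: integrable_fin_num (integrable_window_loss _ tn).
Unshelve. all: by end_near. Qed.

Lemma window_density_loss_le (t h c : R) : 0 < t -> 0 <= h -> phi0 t <= c ->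
  (forall b, mu.-integrable setT (fun z => (W (z - b) * window_density f t h z)%:E)) ->
  \int[mu]_z (W (z - phi0 t) * window_density f t h z) <=
  \int[mu]_z (W (z - c) * window_density f t h z).
Proof.
move=> t0 h0; rewrite le_eqVlt => /orP[/eqP <-//|tc] ih.
apply: (@shifted_loss_transfer (w t)) => //.
- by move=> x; exact: w_ge0.
- by move=> x; apply: window_density_ge0 => //; exact: ltW.
- by move=> x y; apply: window_density_ratio => //; exact: ltW.
- by move=> b; exact: integrable_window_loss.
- exact: window_loss_increasing.
Qed.

End shrinkage.

(** * Integration against laws with densities and independent pairs *)

Section density_change_of_variables.
Context {R : realType}.
Local Notation mu := (@lebesgue_measure R).

(** [g] agrees almost everywhere with the Radon-Nikodym derivative of [nu], for which the change of
    variables holds. *)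
Lemma ge0_integral_density
    (nu : {finite_measure set (measurableTypeR R) -> \bar R}) (g : R -> R) (phi : R -> \bar R) :
  measurable_fun setT g -> (forall x, 0 <= g x) ->
  (forall A, measurable A -> nu A = \int[mu]_(x in A) (g x)%:E)%E ->
  measurable_fun setT phi -> (forall x, 0 <= phi x)%E ->
  (\int[nu]_x phi x = \int[mu]_x (phi x * (g x)%:E))%E.
Proof.
move=> mg g0 nug mphi phi0.
have numu : nu `<< mu.
  apply/null_content_dominatesP => A mA A0; rewrite nug//.
  apply: null_set_integral => //; apply: measurable_funTS.
  exact/measurable_EFinP.
rewrite -(Radon_Nikodym_SigmaFinite.change_of_variables numu)//.
have iRN := Radon_Nikodym_SigmaFinite.f_integrable numu.
apply: ge0_ae_eq_integral => //.
- by apply: emeasurable_funM => //; exact: measurable_int iRN.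
- by apply: emeasurable_funM => //; exact/measurable_EFinP.
- by move=> x _; rewrite mule_ge0// Radon_Nikodym_SigmaFinite.f_ge0.
- by move=> x _; rewrite mule_ge0// lee_fin.
apply: ae_eqe_mul2l; apply: integral_ae_eq => //.
- exact/measurable_EFinP.
- by move=> E _ mE; rewrite -nug// -Radon_Nikodym_SigmaFinite.f_integral.
Qed.

End density_change_of_variables.

Section independent_pair.
Context {R : realType} {d d1 d2 : measure_display} {T : measurableType d}.
Context {E1 : measurableType d1} {E2 : measurableType d2}.
Variables (P : probability T R) (X : {mfun T >-> E1}) (Y : {mfun T >-> E2}).

(** Independence identifies the joint law with the product measure, by uniqueness on rectangles;
    Tonelli then separates the variables. *)
Lemma ge0_integral_independent (h : E1 * E2 -> \bar R) :
  (forall A B, measurable A -> measurable B ->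
    P (X @^-1` A `&` Y @^-1` B) = (P (X @^-1` A) * P (Y @^-1` B))%E) ->
  measurable_fun setT h -> (forall p, 0 <= h p)%E ->
  (\int[P]_w h (X w, Y w) =
   \int[distribution P Y]_y \int[distribution P X]_x h (x, y))%E.
Proof.
move=> iXY mh h0.
have mXY : measurable_fun setT (fun w => (X w, Y w)) by exact: measurable_fun_pair.
pose XY : {mfun T >-> (E1 * E2)%type} := HB.pack (fun w => (X w, Y w))
  (isMeasurableFun.Build _ _ _ _ _ mXY).
transitivity (\int[distribution P XY]_p h p)%E.
  by rewrite ge0_integral_distribution.
transitivity (\int[(distribution P X \x distribution P Y)%E]_p h p)%E.
  apply: eq_measure_integral => A mA _; apply/esym.
  exact: (product_measure_unique (m' := distribution P XY)).
exact: fubini_tonelli2.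
Qed.

End independent_pair.

Lemma independent_RV_sym {R : realType} {d} {T : measurableType d}
    (P : probability T R) (X Y : {mfun T >-> R}) :
  independent_RV P X Y -> independent_RV P Y X.
Proof. by move=> iXY A B mA mB; rewrite setIC muleC; exact: iXY. Qed.

Lemma measurable_density_shift {R : realType} (f : R -> R) (c : R) :
  is_density f -> measurable_fun setT (fun x : R => f (x - c)).
Proof. by case=> mf _ _; exact: measurableT_comp (measurable_addr (- c)). Qed.

Lemma measurable_window {R : realType} (f : R -> R) (t c : R) :
  is_density f -> measurable_fun setT (fun y : R => window f t (y - c)).
Proof.
move=> fd; have mF b : measurable_fun setT (fun y : R => distr_fun f (y - b)).
  exact: measurableT_comp (measurable_distr_fun fd) (measurable_addr (- b)).
apply: measurable_funB => //.
by under eq_fun do rewrite -addrA -opprD; exact: mF.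
Qed.

Lemma measurable_window_density {R : realType} (f : R -> R) (t h : R) :
  is_density f -> measurable_fun setT (window_density f t h).
Proof.
move=> fd; have mf : measurable_fun setT f by case: fd.
have mwin c := measurable_window t c fd.
apply: measurable_funD; apply: measurable_funM => //.
- exact: measurableT_comp mf (measurable_addr _).
- by have := mwin 0; under eq_fun do rewrite subr0.
- by have := mwin (- h); under eq_fun do rewrite opprK.
Qed.

(** * Law of one observation when the other falls in the window below it *)

Section window_law.
Context {R : realType} {d : measure_display} {T : measurableType d}.
Variables (P : probability T R) (X Y : {mfun T >-> R}) (f : R -> R) (a b : R).
Hypotheses (f_density : is_density f).
Hypotheses (X_density : has_density P X (fun x => f (x - a))).
Hypotheses (Y_density : has_density P Y (fun x => f (x - b))).
Hypothesis XY_independent : independent_RV P X Y.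
Local Notation mu := (@lebesgue_measure R).

(* [lebesgue_measure] lives on [measurableTypeR R], whose measurable structure has the
   same sets as that of [R] but is not convertible to it. *)
Let borel (Z : {mfun T >-> R}) : {mfun T >-> measurableTypeR R} :=
  HB.pack (Z : T -> measurableTypeR R)
    (isMeasurableFun.Build _ _ T (measurableTypeR R) _ (measurable_funPT Z)).

Lemma distribution_window (strict : bool) (t y : R) : 0 <= t ->
  distribution P (borel X) [set` Interval (BRight (y - t)) (BSide strict y)] =
  (window f t (y - a))%:E.
Proof.
move=> t0.
have mI (s : bool) : measurable [set` Interval (BRight (y - t)) (BSide s y)].
  exact: measurable_itv.
have fi : mu.-integrable `]y - t, y] (fun x => (f (x - a))%:E).
  exact: integrableS (density_integrable_translation f_density (- a)).
have -> : distribution P (borel X) [set` Interval (BRight (y - t)) (BSide strict y)] =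
    (\int[mu]_(x in `](y - t)%R, y]) (f (x - a))%:E)%E.
  rewrite /distribution /pushforward X_density//.
  case: strict => //; apply: integral_itv_bndo_bndc.
  by apply: measurable_funTS; apply/measurable_EFinP; exact: measurable_density_shift.
rewrite -[LHS]fineK; last exact: integrable_fin_num fi.
congr EFin; have yt : y - t <= y by lra.
have := distr_funB_translation f_density (- a) yt; rewrite /Rintegral => <-.
by rewrite /window [y - t - a]addrAC.
Qed.

(** Both tie conventions are wanted: splitting by the larger observation must count the event
    [X = Y] exactly once. *)
Lemma ge0_integral_window (strict : bool) (t : R) (phi : R -> R) : 0 <= t ->
  measurable_fun setT phi -> (forall x, 0 <= phi x) ->
  (\int[P]_w (if (Y w - t < X w) && (X w < Y w ?<= if ~~ strict) then phi (Y w) else 0)%:E =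
   \int[mu]_y (phi y * (f (y - b) * window f t (y - a)))%:E)%E.
Proof.
move=> t0 mphi phi0.
case: (f_density) => mf f0 _.
pose h (p : R * R) : \bar R :=
  (if (p.2 - t < p.1) && (p.1 < p.2 ?<= if ~~ strict) then phi p.2 else 0)%:E.
have mh : measurable_fun setT h.
  apply/measurable_EFinP; apply: measurable_fun_ifT => //.
    apply: measurable_and.
      apply: measurable_fun_ltr => //; apply: measurable_funB => //.
    by case: (strict) => /=; [apply: measurable_fun_ltr|apply: measurable_fun_ler].
  exact: measurableT_comp mphi measurable_snd.
have h0 p : (0 <= h p)%E by rewrite /h lee_fin; case: ifP.
rewrite -[LHS]/(\int[P]_w h (borel X w, borel Y w))%E.
rewrite ge0_integral_independent //.
transitivity (\int[distribution P (borel Y)]_y (phi y * window f t (y - a))%:E)%E.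
  apply: eq_integral => y _.
  rewrite EFinM -(distribution_window strict)// -integral_cst; last exact: measurable_itv.
  rewrite [RHS]integral_mkcond; apply: eq_integral => x _.
  rewrite patchE /h /= mem_setE in_itv /=; by case: (strict) => /=; case: ifP.
have mwin := measurable_window t a f_density.
transitivity (\int[mu]_y ((phi y * window f t (y - a))%:E * (f (y - b))%:E))%E.
  apply: ge0_integral_density => //.
  - exact: measurable_density_shift.
  - by apply/measurable_EFinP; apply: measurable_funM.
  - by move=> y; rewrite lee_fin mulr_ge0// window_ge0.
by apply: eq_integral => y _; rewrite -EFinM -mulrA [window _ _ _ * _]mulrC.
Qed.

(* The windows with and without ties have the same probability. *)
Lemma independent_RV_neq : P [set w | X w = Y w] = 0%E.
Proof.
pose A (s : bool) := [set w | (Y w - 1 < X w) && (X w < Y w ?<= if ~~ s)].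
have mA s : measurable (A s).
  have mb : measurable_fun setT (fun w => (Y w - 1 < X w) && (X w < Y w ?<= if ~~ s)).
    apply: measurable_and.
      by apply: measurable_fun_ltr => //; apply: measurable_funB.
    by case: s => /=; [apply: measurable_fun_ltr|apply: measurable_fun_ler].
  by have := mb measurableT [set true] I; rewrite setTI.
have PA s : P (A s) = (\int[mu]_y (1 * (f (y - b) * window f 1 (y - a)))%:E)%E.
  rewrite -(@ge0_integral_window s 1 (cst 1))//.
  rewrite -[LHS]mul1e -integral_cst// integral_mkcond; apply: eq_integral => w _.
  rewrite patchE; case: ifPn => [/set_mem /= -> //|].
  by rewrite notin_setE /= => /negP/negbTE ->.
have -> : [set w | X w = Y w] = A false `\` A true.
  apply/seteqP; rewrite /A; split => w /=.
    by move=> ->; rewrite ltxx lexx andbF andbT; split => //; lra.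
  move=> [/andP[H1 H2] /negP]; rewrite H1/= -leNgt => H3.
  by apply/eqP; rewrite eq_le H2.
rewrite measureD//; last by rewrite -ge0_fin_numE// fin_num_measure.
rewrite (_ : _ `&` _ = A true).
  have <- : (P (A false) - P (A true))%E = 0%E; last by [].
  by rewrite !PA subee// -(PA true) fin_num_measure.
by apply/setIidr => w; rewrite /A /= => /andP[-> /ltW].
Qed.

End window_law.

(** * Law of the maximum on the event [U < t] *)

Section range_law.
Context {R : realType} {d : measure_display} {T : measurableType d}.
Variables (P : R * R -> probability T R) (X1 X2 : {mfun T >-> R}) (f : R -> R).
Hypotheses (f_density : is_density f) (model : location_model f P X1 X2).
Local Notation mu := (@lebesgue_measure R).
Variable th : R * R.

Local Notation maxX w := (max2 (X1 w, X2 w)).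
Local Notation minX w := (min2 (X1 w, X2 w)).

Lemma measurable_max2 : measurable_fun setT (fun w => maxX w).
Proof. exact: measurable_maxr. Qed.

Lemma measurable_range : measurable_fun setT (fun w => maxX w - minX w).
Proof. by apply: measurable_funB; [exact: measurable_max2|exact: measurable_minr]. Qed.

Lemma range_ge0 w : 0 <= maxX w - minX w.
Proof. by rewrite subr_ge0 /max2 /min2 /= ge_min le_max lexx. Qed.

(** [phi0] is constrained only at positive arguments, so the event [U = 0] has to be discarded. *)
Lemma range_eq0_null : P th [set w | maxX w - minX w = 0] = 0%E.
Proof.
have [d1 d2 i12] := model th.
rewrite -(independent_RV_neq f_density d1 d2 i12); congr (P th _).
apply/seteqP; split => w /=; rewrite /max2 /min2 /=.
  by case: leP => _; lra.
by move=> ->; rewrite maxxx minxx subrr.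
Qed.

Lemma ge0_integral_range_lt (t : R) (psi : R -> R) : 0 <= t ->
  measurable_fun setT psi -> (forall x, 0 <= psi x) ->
  (\int[P th]_w (if (maxX w - minX w < t)%R then psi (maxX w - max2 th)%R else 0%R)%:E =
   \int[mu]_z (psi z * window_density f t `|th.1 - th.2| z)%:E)%E.
Proof.
move=> t0 mpsi psi0; have [d1 d2 i12] := model th.
set M := max2 th.
pose phi y := psi (y - M).
have mphi : measurable_fun setT phi.
  exact: measurableT_comp mpsi (measurable_addr (- M)).
have mif (s : bool) (X Y : {mfun T >-> R}) : measurable_fun setT (fun w =>
    (if (Y w - t < X w) && (X w < Y w ?<= if ~~ s) then phi (Y w) else 0)%:E).
  apply/measurable_EFinP; apply: measurable_fun_ifT => //.
    apply: measurable_and.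
      by apply: measurable_fun_ltr => //; apply: measurable_funB.
    by case: s => /=; [apply: measurable_fun_ltr|apply: measurable_fun_ler].
  exact: measurableT_comp mphi _.
have f0 x : 0 <= f x by case: f_density.
have mfs c : measurable_fun setT (fun y : R => f (y - c)).
  exact: measurable_density_shift.
have mwin c : measurable_fun setT (fun y : R => window f t (y - c)).
  exact: measurable_window.
(* The maximum is [X2] in the first term, ties included, and [X1] in the second. *)
transitivity (\int[P th]_w (
  (if (X2 w - t < X1 w) && (X1 w < X2 w ?<= if ~~ false) then phi (X2 w) else 0)%:E +
  (if (X1 w - t < X2 w) && (X2 w < X1 w ?<= if ~~ true) then phi (X1 w) else 0)%:E))%E.
  apply: eq_integral => w _; rewrite -EFinD; congr EFin.
  rewrite /max2 /min2 /phi /=; case: (leP (X1 w) (X2 w)) => h.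
    by rewrite andbT andbF addr0 ltrBlDl -ltrBlDr.
  by rewrite andbT andbF add0r ltrBlDl -ltrBlDr.
rewrite ge0_integralD//; last 2 first.
- by move=> w _; rewrite lee_fin; case: ifP => // _; exact: psi0.
- by move=> w _; rewrite lee_fin; case: ifP => // _; exact: psi0.
have phi0 y : 0 <= phi y by exact: psi0.
rewrite (ge0_integral_window f_density d1 d2 i12)//.
rewrite (ge0_integral_window f_density d2 d1 (independent_RV_sym i12))//.
have mg c c' : measurable_fun setT
    (fun y : R => (phi y * (f (y - c) * window f t (y - c')))%:E).
  by apply/measurable_EFinP; do 2 apply: measurable_funM => //.
have g0 c c' (y : R) : (0 <= (phi y * (f (y - c) * window f t (y - c')))%:E)%E.
  by rewrite lee_fin !mulr_ge0// window_ge0.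
have <- := ge0_integralD mu measurableT (fun y _ => g0 th.2 th.1 y) (mg th.2 th.1)
  (fun y _ => g0 th.1 th.2 y) (mg th.1 th.2).
have mG : measurable_fun setT (fun z : R => (psi z * window_density f t `|th.1 - th.2| z)%:E).
  apply/measurable_EFinP; apply: measurable_funM => //.
  exact: measurable_window_density.
have G0 (z : R) : setT z -> (0 <= (psi z * window_density f t `|th.1 - th.2| z)%:E)%E.
  by move=> _; rewrite lee_fin mulr_ge0// window_density_ge0.
(* Recentring at [M] turns the two location shifts into 0 and [|th.1 - th.2|]. *)
have <- := ge0_integral_translation (- M) measurableT mG G0.
apply: eq_integral => y _; rewrite -EFinD; congr EFin.
rewrite -mulrDr /phi /window_density; congr (_ * _).
rewrite /M /max2; case: (leP th.1 th.2) => h.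
  rewrite ler0_norm ?subr_le0//.
  by rewrite (_ : y - th.2 - (th.1 - th.2) = y - th.1) 1?addrC//; ring.
rewrite gtr0_norm ?subr_gt0//.
by rewrite (_ : y - th.1 + (th.1 - th.2) = y - th.2)//; ring.
Qed.

End range_law.

(** * Step rules *)

Section step_rules.
Context {R : realType}.
Variables (phi : R -> R) (b : R).

(** Nested cuts: prepending [t] alters the rule only below [t], which is exactly one replacement;
    [b] serves beyond the last point. *)
Definition step_rule (ts : seq R) : R -> R :=
  foldr (fun t psi u => if u < t then phi t else psi u) (cst b) ts.

Lemma measurable_step_rule ts : measurable_fun setT (step_rule ts).
Proof.
elim: ts => [|t ts IH] /=; first exact: measurable_cst.
by apply: measurable_fun_ifT => //; apply: measurable_fun_ltr.
Qed.

(** The first grid point beyond [u] is [g m] or the successor of a point at most [u], so it does not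
    exceed [u + h]. *)
Lemma step_rule_grid (g : nat -> R) (u h : R) (m n : nat) :
  (forall i, g i.+1 <= g i + h) -> g m <= u + h -> u < g (m + n)%N ->
  exists2 t, u < t <= u + h & step_rule [seq g i | i <- iota m n.+1] u = phi t.
Proof.
move=> gh; elim: n m => [|n IH] m gm un.
  rewrite addn0 in un; rewrite /= un; exists (g m) => //; exact/andP.
have -> : iota m n.+2 = m :: iota m.+1 n.+1 by [].
rewrite map_cons [step_rule _ _]/=.
have [um|mu] := ltP u (g m); first by exists (g m) => //; exact/andP.
apply: IH; last by rewrite addSnnS.
by apply: (le_trans (gh _)); rewrite lerD2r.
Qed.

End step_rules.

(** * Risk of step rules *)

Section risk_of_step_rules.
Context {R : realType} {d : measure_display} {T : measurableType d}.
Variables (P : R * R -> probability T R) (X1 X2 : {mfun T >-> R}).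
Variables (f W : R -> R) (b0 : R) (phi0 : R -> R).
Hypotheses (f_density : is_density f) (model : location_model f P X1 X2).
Hypotheses (f_MLR : MLR f) (W_ge0 : forall x, 0 <= W x) (W_cont : continuous W).
Hypotheses (W_C1 : condC1 W) (W_C2 : condC2 W) (W_C3 : condC3 W f P X1 X2).
Hypothesis b0_unique : unique (fun b => k W f b = 0) b0.
Hypothesis phi0_unique : forall t : R, 0 < t -> unique (fun c => k1 W f c t = 0) (phi0 t).
Variable th : R * R.
Local Notation mu := (@lebesgue_measure R).
Local Notation U w := (max2 (X1 w, X2 w) - min2 (X1 w, X2 w)).
Local Notation Z w := (max2 (X1 w, X2 w) - max2 th).
Local Notation h := (`|th.1 - th.2|).

Let mW : measurable_fun setT W. Proof. exact: continuous_measurable_fun. Qed.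

Let mWs (c : R) : measurable_fun setT (fun z : R => W (z - c)).
Proof. exact: measurableT_comp mW (measurable_addr (- c)). Qed.

Lemma riskE psi : risk W P X1 X2 th (delta_phi psi) =
  (\int[P th]_w (W (Z w - psi (U w)))%:E)%E.
Proof.
rewrite /risk unlock; apply: eq_integral => w _.
by rewrite /delta_phi addrAC.
Qed.

Lemma measurable_loss (psi : R -> R) : measurable_fun setT psi ->
  measurable_fun setT (fun w => W (Z w - psi (U w))).
Proof.
move=> mpsi; apply: (measurableT_comp mW); apply: measurable_funB.
  by apply: measurable_funB => //; exact: measurable_max2.
exact: measurableT_comp mpsi (measurable_range X1 X2).
Qed.

Lemma risk_split (t : R) psi : measurable_fun setT psi ->
  risk W P X1 X2 th (delta_phi psi) =
  (\int[P th]_w (if (U w < t)%R then W (Z w - psi (U w))%R else 0%R)%:E +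
   \int[P th]_w (if (U w < t)%R then 0%R else W (Z w - psi (U w))%R)%:E)%E.
Proof.
move=> mpsi; rewrite riskE -ge0_integralD//.
- by apply: eq_integral => w _; rewrite -EFinD; case: ifP; rewrite ?addr0 ?add0r.
- by move=> w _; rewrite lee_fin; case: ifP.
- apply/measurable_EFinP; apply: measurable_fun_ifT => //.
    by apply: measurable_fun_ltr => //; exact: measurable_range.
  exact: measurable_loss.
- by move=> w _; rewrite lee_fin; case: ifP.
- apply/measurable_EFinP; apply: measurable_fun_ifT => //.
    by apply: measurable_fun_ltr => //; exact: measurable_range.
  exact: measurable_loss.
Qed.

(** The integral is the share of the event [U < t] in the risk of a constant rule, finite by the
    last clause of (C3). *)
Lemma integrable_window_density_loss (t c : R) : 0 <= t ->
  mu.-integrable setT (fun z => (W (z - c) * window_density f t h z)%:E).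
Proof.
move=> t0; have mG := measurable_window_density t h f_density.
apply/integrableP; split.
  by apply/measurable_EFinP; apply: measurable_funM; [exact: mWs|].
under eq_integral do rewrite /= ger0_norm ?mulr_ge0 ?window_density_ge0//.
rewrite -(ge0_integral_range_lt f_density model th t0 (mWs c))//.
have [_ _ fin] := W_C3; apply: le_lt_trans (fin th c).
rewrite /delta_cst -[X in risk _ _ _ _ _ X]/(delta_phi (cst c)) (@risk_split t)//.
by rewrite leeDl// integral_ge0// => w _; rewrite lee_fin; case: ifP.
Qed.

(** Nothing changes where [U >= t]; where [U < t] both rules are constant and
    [window_density_loss_le] compares them. *)
Lemma risk_cut_le (t c : R) (psi : R -> R) : 0 < t -> phi0 t <= c ->
  measurable_fun setT psi -> (forall u, u < t -> psi u = c) ->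
  (risk W P X1 X2 th (delta_phi (fun u => if (u < t)%R then phi0 t else psi u)) <=
   risk W P X1 X2 th (delta_phi psi))%E.
Proof.
move=> t0 tc mpsi psic; have t0' := ltW t0.
rewrite (@risk_split t); last first.
  by apply: measurable_fun_ifT => //; apply: measurable_fun_ltr.
rewrite (@risk_split t psi)//; apply: leeD; last first.
  rewrite le_eqVlt; apply/orP; left; apply/eqP; apply: eq_integral => w _.
  by case: (_ < t).
have -> : (\int[P th]_w (if (U w < t)%R
      then W (Z w - (if (U w < t)%R then phi0 t else psi (U w)))%R else 0%R)%:E =
    \int[mu]_z (W (z - phi0 t) * window_density f t h z)%:E)%E.
  rewrite -(ge0_integral_range_lt f_density model th t0' (mWs (phi0 t)))//.
  by apply: eq_integral => w _; case: (_ < t).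
have -> : (\int[P th]_w (if (U w < t)%R then W (Z w - psi (U w))%R else 0%R)%:E =
    \int[mu]_z (W (z - c) * window_density f t h z)%:E)%E.
  rewrite -(ge0_integral_range_lt f_density model th t0' (mWs c))//.
  by apply: eq_integral => w _; case: ifP => // /psic ->.
have fn b := integrable_fin_num measurableT (integrable_window_density_loss b t0').
rewrite -(fineK (fn (phi0 t))) -(fineK (fn c)) lee_fin.
have [_ C3w _] := W_C3.
apply: (window_density_loss_le W_ge0 W_C1 W_C2 f_density f_MLR C3w phi0_unique) => //.
by move=> b; exact: integrable_window_density_loss.
Qed.

Lemma risk_step_rule_le (ts : seq R) : all (fun t => 0 < t) ts -> sorted <=%R ts ->
  (risk W P X1 X2 th (delta_phi (step_rule phi0 b0 ts)) <=
   risk W P X1 X2 th (delta_cst b0))%E.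
Proof.
have [C3F C3w _] := W_C3.
elim: ts => [//|t ts IH] /= /andP[t0 ts0] tts.
apply: le_trans (IH ts0 (path_sorted tts)).
(* The constant value of the current rule below [t]: that of the next grid point, or [b0] when [t]
   is the last one. *)
pose c := if ts is s :: _ then phi0 s else b0.
apply: (@risk_cut_le t c) => //.
- rewrite /c; case: ts tts ts0 {IH c} => [_ _|s ts' /= /andP[ts _] _].
    exact: (phi0_le_b0 W_ge0 W_C1 W_C2 f_density f_MLR C3F C3w b0_unique phi0_unique).
  exact: (phi0_nd W_ge0 W_C1 W_C2 f_density f_MLR C3w phi0_unique).
- exact: measurable_step_rule.
- rewrite /c; case: ts tts {IH ts0 c} => [//|s ts' /= /andP[ts _] u ut].
  by rewrite (lt_le_trans ut ts).
Qed.

End risk_of_step_rules.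

(** * Convergence of step rules along refining grids *)

Section grid.
Context {R : realType}.

(** The mesh is [1/(n+1)] and the last of the [(n+1)^2 + 1] points exceeds [n + 1], so every [u > 0]
    is eventually covered. Starting at [i.+1] keeps all points positive. *)
Definition grid (n : nat) : seq R :=
  [seq i.+1%:R / n.+1%:R | i <- iota 0 (n.+1 * n.+1).+1].

Lemma grid_gt0 n : all (fun t => 0 < t) (grid n).
Proof. by apply/allP => _ /mapP[i _ ->]; rewrite divr_gt0. Qed.

Lemma sorted_grid n : sorted <=%R (grid n).
Proof.
apply: (homo_sorted (e := leq)) (iota_sorted _ _) => i j ij.
by rewrite ler_pM2r ?invr_gt0// ler_nat ltnS.
Qed.

(** The rule evaluates [phi] at a point between [u] and [u + 1/(n+1)]; monotonicity and right
    continuity squeeze that value. *)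
Lemma step_rule_grid_cvg (phi : R -> R) (b u : R) : 0 < u ->
  (forall s t, 0 < s -> s <= t -> phi s <= phi t) ->
  (forall e, 0 < e -> exists n, phi (u + n.+1%:R^-1) <= phi u + e) ->
  step_rule phi b (grid n) u @[n --> \oo] --> phi u.
Proof.
move=> u0 phi_nd phi_right; apply/cvgrPdist_le => e e0.
have [m hm] := phi_right _ e0.
near=> n.
have un : u < n.+1%:R.
  by near: n; apply: filterS (nbhs_infty_gtr u) => n un; rewrite (lt_trans un)// ltr_nat.
have mn : (m <= n)%N by near: n; exact: nbhs_infty_ge.
have n0 : 0 < n.+1%:R :> R by [].
have [i|||t /andP[ut tu] ->] := @step_rule_grid _ phi b (fun i => i.+1%:R / n.+1%:R) u n.+1%:R^-1 0 (n.+1 * n.+1).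
- by rewrite -[in leLHS]natr1 mulrDl mul1r.
- by rewrite mul1r lerDr ltW.
- rewrite add0n ltr_pdivlMr//; apply: lt_le_trans (_ : n.+1%:R * n.+1%:R <= _).
    by rewrite ltr_pM2r.
  by rewrite -natrM ler_nat.
have le1 : phi u <= phi t by apply: phi_nd => //; exact: ltW.
have le2 : phi t <= phi u + e.
  apply: le_trans hm; apply: phi_nd; first exact: lt_trans ut.
  by apply: (le_trans tu); rewrite lerD2l lef_pV2 ?posrE// ler_nat ltnS.
by rewrite distrC ger0_norm ?subr_ge0// lerBlDl.
Unshelve. all: by end_near. Qed.

End grid.

(** * Passage to the limit *)

Lemma limn_einf_le {R : realType} (u : (\bar R)^nat) (l : \bar R) :
  (forall n, u n <= l)%E -> (limn_einf u <= l)%E.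
Proof.
move=> ul; rewrite limn_einf_lim; apply: lime_le; first exact: is_cvg_einfs.
apply: nearW => n; apply: le_trans (ul n).
by apply: ereal_inf_lbound; exists n => /=.
Qed.

(** Absolute continuity on [[x - 1, x + 1]], used with a single interval. *)
Lemma abs_continuous_continuous {R : realType} (W : R -> R) :
  abs_continuous W -> continuous W.
Proof.
move=> W_ac x; apply/cvgrPdist_lt => e e0.
have xx : x - 1 <= x + 1 by lra.
have [dlt dlt0 hW] := W_ac _ _ xx e e0.
near=> y.
have y1 : `|x - y| < 1.
  by near: y; apply: (@cvgr_dist_lt _ _ _ (nbhs x)) => //.
have yd : `|x - y| < dlt.
  by near: y; apply: (@cvgr_dist_lt _ _ _ (nbhs x)) => //.
have key p q : p <= q -> x - 1 <= p -> q <= x + 1 -> q - p < dlt -> `|W q - W p| < e.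
  move=> pq xp qx qp.
  have := hW 1%N (fun=> p) (fun=> q); rewrite !big_ord1; apply => //.
  by move=> i j _ _ _; rewrite (ord1 i) (ord1 j).
move: y1 yd; case: (leP x y) => xy.
  by rewrite ler0_norm ?subr_le0// opprB => y1 yd; rewrite distrC; apply: key; lra.
by rewrite gtr0_norm ?subr_gt0// => y1 yd; apply: key => //; lra.
Unshelve. all: by end_near. Qed.

Theorem corollary2p6 (R : realType)
    (d : measure_display) (T : measurableType d)
    (P : R * R -> probability T R) (X1 X2 : {mfun T >-> R})
    (f W : R -> R) (b0 : R) (phi0 : R -> R)
    (f_density : is_density f)
    (model : location_model f P X1 X2)
    (f_MLR : MLR f)
    (W_ge0 : forall x : R, 0 <= W x)
    (W_ac : abs_continuous W)
    (W_C1 : condC1 W)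
    (W_C2 : condC2 W)
    (W_C3 : condC3 W f P X1 X2)
    (b0_unique : unique (fun b => k W f b = 0) b0)
    (phi0_unique : forall t : R, 0 < t ->
       unique (fun c => k1 W f c t = 0) (phi0 t)) :
  forall theta : R * R,
    (risk W P X1 X2 theta (delta_phi phi0) <=
     risk W P X1 X2 theta (delta_cst b0))%E.
Proof.
move=> theta.
have W_cont := abs_continuous_continuous W_ac.
have [C3F C3w _] := W_C3.
pose U w := max2 (X1 w, X2 w) - min2 (X1 w, X2 w).
pose V psi w := W (max2 (X1 w, X2 w) - max2 theta - psi (U w)).
pose N := [set w | U w = 0].
pose psi n := step_rule phi0 b0 (grid n).
have mU : measurable_fun setT U by exact: measurable_range.
have mN : measurable N.
  by rewrite -[N]setTI; exact: (mU measurableT [set 0] (measurable_set1 0)).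
have N0 : P theta N = 0%E := range_eq0_null f_density model theta.
have mD : measurable (setT `\` N) by exact: measurableD.
have mV rho : measurable_fun setT rho -> measurable_fun setT (V rho).
  exact: measurable_loss.
have cvgV w : (setT `\` N) w -> V (psi n) w @[n --> \oo] --> V phi0 w.
  move=> [_ /eqP Uw].
  have U0 : 0 < U w by rewrite lt_neqAle eq_sym Uw range_ge0.
  have cvg_step : psi n (U w) @[n --> \oo] --> phi0 (U w).
    apply: step_rule_grid_cvg => //.
    - exact: (phi0_nd W_ge0 W_C1 W_C2 f_density f_MLR C3w phi0_unique).
    - by move=> e; exact: (phi0_right_continuous W_ge0 W_C2 f_density C3w phi0_unique).
  exact: (cvg_comp _ _ (cvgB (cvg_cst _) cvg_step) (W_cont _)).
(* [phi0] is not assumed measurable: off [N] measurability passes to the limit from the step rules,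
   and on [N] the rule is the constant [phi0 0]. *)
have mVphi0 : measurable_fun setT (V phi0).
  have -> : setT = (setT `\` N) `|` N.
    by apply/seteqP; split => // w _; have [|] := pselect (N w); [right|left].
  apply/measurable_funU => //; split.
    apply: (measurable_fun_cvg (h := fun n => V (psi n))) => // n.
    by apply: measurable_funTS; apply: mV; exact: measurable_step_rule.
  apply: (eq_measurable_fun (V (cst (phi0 0)))).
    by move=> w /set_mem Nw; rewrite /V /= Nw.
  exact: measurable_funTS (mV _ (measurable_cst _)).
rewrite riskE (ge0_negligible_integral mN)//; last 2 first.
- exact/measurable_EFinP.
- by move=> w _; rewrite lee_fin; exact: W_ge0.
(* Off [N] the loss is a limit, hence a lower limit, the form that Fatou's lemma takes. *)
have -> : (\int[P theta]_(w in setT `\` N) (V phi0 w)%:E =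
    \int[P theta]_(w in setT `\` N) limn_einf (fun n => (V (psi n) w)%:E))%E.
  apply: eq_integral => w /set_mem Dw; apply/esym.
  have cvgVE : (V (psi n) w)%:E @[n --> \oo] --> (V phi0 w)%:E.
    by apply: cvg_EFin; [exact: nearW|exact: cvgV].
  by have [-> _] := cvg_limn_einf_sup cvgVE.
apply: le_trans (fatou (P theta) mD _ _) _.
- move=> n; apply/measurable_EFinP/measurable_funTS/mV.
  exact: measurable_step_rule.
- by move=> n w _; rewrite lee_fin; exact: W_ge0.
apply: limn_einf_le => n.
(* Restricting to the complement of [N] only lowers the risk of the step rule, which is already at
   most that of [b0]. *)
apply: le_trans (risk_step_rule_le f_density model f_MLR W_ge0 W_cont W_C1 W_C2 W_C3
  b0_unique phi0_unique theta (grid_gt0 n) (sorted_grid n)).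
rewrite riskE; apply: ge0_subset_integral => //.
- by apply/measurable_EFinP; apply: mV; exact: measurable_step_rule.
- by move=> w _; rewrite lee_fin; exact: W_ge0.
Qed.
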